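(* Let $n,\ell\in\mathbb N$, let $U\in\mathcal M_{(n+1)\times(n+1)}(\mathbb R)$ be a (time-independent) symmetric matrix, and let $P:\mathbb R_0^+\to\mathcal M_{(n+1)\times(n+1)}(\mathbb R)$ be bounded, i.e. $\sup_{t\in\mathbb R_0^+}\|P(t)\|<\infty$. Consider on $(\mathbb S^n)^\ell$ the auto-regressive single-head system $$\dot{\mathrm y}_i=\left(\mathbb I_{n+1}-\mathrm y_i\mathrm y_i^\top\right)\left(\sum_{j=1}^{i}\alpha_{ij}(t,\mathbf y)\,U\mathrm y_j\right),\qquad 1\le i\le\ell,$$ where $\mathbf y=(\mathrm y_1,\dots,\mathrm y_\ell)$ and, for $j\le i$, $$\alpha_{ij}(t,\mathbf y)=\frac{\exp(\mathrm y_i^\top P(t)\mathrm y_j)}{\sqrt{n+1}\sum_{k=1}^i\exp(\mathrm y_i^\top P(t)\mathrm y_k)}.$$ Let $\lambda$ be the largest eigenvalue of $U$, let $L_\lambda(U)\subset\mathbb R^{n+1}$ be the corresponding eigenspace, suppose that $\dim L_\lambda(U)=1$, and let $v\in L_\lambda(U)\cap\mathbb S^n$. If $\lambda>0$, then $\mathbf y^*=(v,\dots,v)$ is an asymptotically stable equilibrium of this system and its domain of attraction contains the set $$\mathcal D^\ell(v)=\{(\mathrm y_1,\dots,\mathrm y_\ell)\in(\mathbb S^n)^\ell\mid v^\top\mathrm y_i>0,\ 1\le i\le\ell\}.$$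
   Context: $\mathbb N=\{1,2,\dots\}$, $\mathbb R_0^+=[0,\infty)$, $\|\cdot\|$ is the Frobenius norm, and $\mathbb S^n$ is the unit sphere in $\mathbb R^{n+1}$ with the Euclidean norm. The initial time is $t=0$. An equilibrium is asymptotically stable if it is Lyapunov stable and solutions starting sufficiently close to it converge to it as $t\to\infty$. Its domain of attraction is the set of initial conditions whose solutions converge to it as $t\to\infty$. *)

(* Defs.v *)
From HB Require Import structures.
From mathcomp Require Import all_boot all_order all_algebra.
From mathcomp Require Import all_classical all_reals all_analysis.

Set Implicit Arguments.
Unset Strict Implicit.
Unset Printing Implicit Defensive.

Import Order.TTheory GRing.Theory Num.Theory.
Import numFieldNormedType.Exports.

Local Open Scope classical_set_scope.
Local Open Scope ring_scope.

(* Frobenius norm; on column vectors this is the Euclidean norm.  The library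
   norm `|A| on matrices is the max norm. *)
Definition fnorm (R : realType) (m n : nat) (A : 'M[R]_(m, n)) : R :=
  Num.sqrt (\sum_(i < m) \sum_(j < n) A i j ^+ 2).

Definition unit_sphere (R : realType) (n : nat) : set 'cV[R]_n.+1 :=
  [set x | fnorm x = 1].
Arguments unit_sphere : clear implicits.

Definition dotv (R : realType) (n : nat) (x y : 'cV[R]_n) : R :=
  (x^T *m y) 0 0.

(* States (y_1, ..., y_l) of l tokens; the tokens are indexed from 0. *)
Definition state (R : realType) (n l : nat) : Type := 'I_l -> 'cV[R]_n.+1.

Definition sphere_prod (R : realType) (n l : nat) : set (state R n l) :=
  [set y | forall i, unit_sphere R n (y i)].
Arguments sphere_prod : clear implicits.

Definition state_dist (R : realType) (n l : nat) (x y : state R n l) : R :=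
  Num.sqrt (\sum_(i < l) fnorm (x i - y i) ^+ 2).

(* Absolute continuity on the compact interval [c, d]. *)
Definition abs_continuous (R : realType) (V : normedModType R)
    (c d : R) (f : R -> V) : Prop :=
  forall e : R, 0 < e -> exists2 delta : R, 0 < delta &
    forall (m : nat) (a b : 'I_m -> R),
      (forall k, [/\ c <= a k, a k <= b k & b k <= d]) ->
      trivIset [set: 'I_m] (fun k => `]a k, b k[%classic) ->
      \sum_(k < m) (b k - a k) < delta ->
      \sum_(k < m) `|f (b k) - f (a k)| < e.

(* Global Caratheodory solutions, on [0, +oo[, of y' = f(t, y) in a set X of
   states.  The values of y at negative times are irrelevant.  No regularity in
   t is assumed of f: when f is bounded on X, every solution that is
   continuous on [0, +oo[ and differentiable with y' = f(t, y) at every t > 0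
   is a solution in this sense. *)
Definition is_solution (R : realType) (n l : nat) (X : set (state R n l))
    (f : R -> state R n l -> state R n l) (y : R -> state R n l) : Prop :=
  [/\ forall t, 0 <= t -> X (y t),
      forall i (T : R), 0 <= T -> abs_continuous 0 T (fun t => y t i)
    & {ae @lebesgue_measure R, forall t : R, 0 < t ->
        forall i, is_derive t 1 (fun s => y s i) (f t (y t) i)}].

Definition is_equilibrium (R : realType) (n l : nat) (X : set (state R n l))
    (f : R -> state R n l -> state R n l) (x : state R n l) : Prop :=
  X x /\ forall t, 0 <= t -> forall i, f t x i = 0.

Definition converges_to (R : realType) (n l : nat)
    (y : R -> state R n l) (x : state R n l) : Prop :=
  state_dist (y t) x @[t --> +oo] --> (0 : R).

Definition lyapunov_stable (R : realType) (n l : nat) (X : set (state R n l))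
    (f : R -> state R n l -> state R n l) (x : state R n l) : Prop :=
  forall e : R, 0 < e -> exists2 delta : R, 0 < delta &
    forall y, is_solution X f y -> state_dist (y 0) x < delta ->
      forall t, 0 <= t -> state_dist (y t) x < e.

Definition domain_of_attraction (R : realType) (n l : nat)
    (X : set (state R n l)) (f : R -> state R n l -> state R n l)
    (x : state R n l) : set (state R n l) :=
  [set y0 | X y0 /\
    forall y, is_solution X f y -> y 0 = y0 -> converges_to y x].

Definition asymptotically_stable (R : realType) (n l : nat)
    (X : set (state R n l)) (f : R -> state R n l -> state R n l)
    (x : state R n l) : Prop :=
  lyapunov_stable X f x /\
  exists2 delta : R, 0 < delta &
    [set y0 | X y0 /\ state_dist y0 x < delta] `<=`
    domain_of_attraction X f x.

Definition attn_score (R : realType) (n l : nat) (Pt : 'M[R]_n.+1)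
    (y : state R n l) (i j : 'I_l) : R :=
  expR (((y i)^T *m Pt *m y j) 0 0).

(* The attention weight alpha_ij, used only for j <= i. *)
Definition attn_weight (R : realType) (n l : nat) (Pt : 'M[R]_n.+1)
    (y : state R n l) (i j : 'I_l) : R :=
  attn_score Pt y i j /
  (Num.sqrt n.+1%:R * \sum_(k < l | (k <= i)%N) attn_score Pt y i k).

Definition attn_field (R : realType) (n l : nat) (U : 'M[R]_n.+1)
    (P : R -> 'M[R]_n.+1) (t : R) (y : state R n l) : state R n l :=
  fun i => (1%:M - y i *m (y i)^T) *m
    (\sum_(j < l | (j <= i)%N) attn_weight (P t) y i j *: (U *m y j)).

Definition largest_eigenvalue (R : realType) (n : nat) (U : 'M[R]_n)
    (lambda : R) : Prop :=
  eigenvalue U lambda /\ forall mu, eigenvalue U mu -> mu <= lambda.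

Definition open_hemisphere_prod (R : realType) (n l : nat) (v : 'cV[R]_n.+1) :
    set (state R n l) :=
  [set y | sphere_prod R n l y /\ forall i, 0 < dotv v (y i)].

(* Main.v *)
(** Write c_i = v . y_i and let z_i = y_i - c_i v be the component of y_i
    orthogonal to v.  Since U v = lambda v,
      c_i' = sum_(j <= i) alpha_ij
               (lambda c_j (1 - c_i^2) - c_i z_i . U z_j).
    The term j = i is at least alpha_ii (lambda - mu) c_i (1 - c_i^2), where
    mu < lambda bounds U on the orthogonal complement of v; the term j < i is at
    least alpha_ij lambda c_j (1 - c_i^2) up to an error of order |z_j|.  As P is
    bounded, the weights alpha_ij are bounded away from 0, and the first term of
    the sum alone keeps c_i away from 0 and drives it to 1 as soon as the
    previous tokens are close to v; stability and attraction follow by induction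
    on i.  The solutions are only absolutely continuous, so the comparison
    arguments rest on the fact that an absolutely continuous function whose
    derivative is nonnegative almost everywhere is nondecreasing. *)

Require Import Defs.
From HB Require Import structures.
From mathcomp Require Import all_boot all_order all_algebra.
From mathcomp Require Import all_classical all_reals all_analysis.
From mathcomp Require Import ring lra.
Import Order.TTheory GRing.Theory Num.Theory.
Import numFieldNormedType.Exports.
Local Open Scope classical_set_scope.
Local Open Scope ring_scope.
Set Implicit Arguments.
Unset Strict Implicit.
Unset Printing Implicit Defensive.

(** * Euclidean structure and spectral gap *)

Lemma dotvE (R : realType) (n : nat) (x y : 'cV[R]_n) :
  dotv x y = \sum_(i < n) x i 0 * y i 0.
Proof. by rewrite /dotv mxE; apply: eq_bigr => i _; rewrite mxE. Qed.

Lemma dotvC (R : realType) (n : nat) (x y : 'cV[R]_n) : dotv x y = dotv y x.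
Proof. by rewrite !dotvE; apply: eq_bigr => i _; rewrite mulrC. Qed.

Lemma dotvDr (R : realType) (n : nat) (x y z : 'cV[R]_n) :
  dotv x (y + z) = dotv x y + dotv x z.
Proof. by rewrite /dotv mulmxDr mxE. Qed.

Lemma dotvZr (R : realType) (n : nat) (a : R) (x y : 'cV[R]_n) :
  dotv x (a *: y) = a * dotv x y.
Proof. by rewrite /dotv -scalemxAr mxE. Qed.

Lemma dotvBr (R : realType) (n : nat) (x y z : 'cV[R]_n) :
  dotv x (y - z) = dotv x y - dotv x z.
Proof. by rewrite dotvDr -scaleN1r dotvZr mulN1r. Qed.

Lemma dotvDl (R : realType) (n : nat) (x y z : 'cV[R]_n) :
  dotv (x + y) z = dotv x z + dotv y z.
Proof. by rewrite !(dotvC _ z) dotvDr. Qed.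

Lemma dotvZl (R : realType) (n : nat) (a : R) (x y : 'cV[R]_n) :
  dotv (a *: x) y = a * dotv x y.
Proof. by rewrite !(dotvC _ y) dotvZr. Qed.

Lemma dotvBl (R : realType) (n : nat) (x y z : 'cV[R]_n) :
  dotv (x - y) z = dotv x z - dotv y z.
Proof. by rewrite !(dotvC _ z) dotvBr. Qed.

Lemma dotv_sumr (R : realType) (n : nat) (I : Type) (r : seq I) (p : pred I)
    (x : 'cV[R]_n) (F : I -> 'cV[R]_n) :
  dotv x (\sum_(i <- r | p i) F i) = \sum_(i <- r | p i) dotv x (F i).
Proof. by rewrite /dotv mulmx_sumr summxE. Qed.

Lemma dotv_mulmx (R : realType) (m n : nat) (A : 'M[R]_(m, n))
    (x : 'cV[R]_m) (y : 'cV[R]_n) : dotv x (A *m y) = dotv (A^T *m x) y.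
Proof. by rewrite /dotv trmx_mul trmxK mulmxA. Qed.

Lemma sqr_fnorm (R : realType) (m n : nat) (A : 'M[R]_(m, n)) :
  fnorm A ^+ 2 = \sum_(i < m) \sum_(j < n) A i j ^+ 2.
Proof.
rewrite sqr_sqrtr//; apply: sumr_ge0 => i _; apply: sumr_ge0 => j _.
exact: sqr_ge0.
Qed.

Lemma fnorm_ge0 (R : realType) (m n : nat) (A : 'M[R]_(m, n)) : 0 <= fnorm A.
Proof. exact: sqrtr_ge0. Qed.

Lemma dotvv (R : realType) (n : nat) (x : 'cV[R]_n) : dotv x x = fnorm x ^+ 2.
Proof.
by rewrite dotvE sqr_fnorm; apply: eq_bigr => i _; rewrite big_ord1 expr2.
Qed.

Lemma fnorm0 (R : realType) (n : nat) : fnorm (0 : 'cV[R]_n) = 0.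
Proof. by apply/eqP; rewrite -sqrf_eq0 -dotvv /dotv mulmx0 mxE. Qed.

Lemma entry_le_fnorm (R : realType) (m n : nat) (A : 'M[R]_(m, n)) i j :
  `|A i j| <= fnorm A.
Proof.
rewrite -(@ler_pXn2r _ 2) ?nnegrE ?fnorm_ge0// sqr_fnorm real_normK ?num_real//.
rewrite (bigD1 i)//= (bigD1 j)//= -addrA lerDl; apply: addr_ge0.
  by apply: sumr_ge0 => k _; exact: sqr_ge0.
by apply: sumr_ge0 => k _; apply: sumr_ge0 => h _; exact: sqr_ge0.
Qed.

Lemma fnorm_eq0 (R : realType) (n : nat) (x : 'cV[R]_n) :
  fnorm x = 0 -> x = 0.
Proof.
move=> x0; apply/matrixP => i j; rewrite [RHS]mxE; apply/eqP.
by rewrite -normr_le0 -x0 entry_le_fnorm.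
Qed.

(** Entrywise estimates replace Cauchy-Schwarz; the factor [m * n] counts the terms, and the size of
    the constant is immaterial later. *)
Lemma norm_dotv_le (R : realType) (m n : nat) (A : 'M[R]_(m, n))
    (x : 'cV[R]_m) (y : 'cV[R]_n) :
  `|dotv x (A *m y)| <= (m * n)%:R * fnorm A * (fnorm x * fnorm y).
Proof.
rewrite dotvE; apply: le_trans (ler_norm_sum _ _ _) _.
have -> : (m * n)%:R * fnorm A * (fnorm x * fnorm y) =
    \sum_(i < m) \sum_(j < n) fnorm x * (fnorm A * fnorm y).
  by rewrite !sumr_const !card_ord -mulrnA mulnC -[RHS]mulr_natl; ring.
apply: ler_sum => i _; rewrite normrM mxE -mulr_sumr.
apply: ler_pM => //; first exact: entry_le_fnorm.
apply: le_trans (ler_norm_sum _ _ _) _; apply: ler_sum => j _.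
by rewrite normrM; apply: ler_pM => //; exact: entry_le_fnorm.
Qed.

Lemma continuous_sum (R : realType) (T : topologicalType) (n : nat)
    (F : 'I_n -> T -> R) :
  (forall i, continuous (F i)) -> continuous (fun x => \sum_(i < n) F i x).
Proof.
move=> Fc; apply: (@continuous_big R 'I_n +%R 0 xpredT) => //.
by move=> x; apply: cvgD; [exact: cvg_fst|exact: cvg_snd].
Qed.

Lemma continuous_dotv (R : realType) (n : nat) (v : 'cV[R]_n) :
  continuous (fun x : 'rV[R]_n => dotv v x^T).
Proof.
rewrite [X in continuous X](_ : _ = fun x : 'rV[R]_n =>
    \sum_(i < n) v i 0 * x 0 i).
  apply: continuous_sum => i x.
  by apply: continuousM; [exact: cst_continuous|exact: coord_continuous].
by apply/funext => x; rewrite dotvE; apply: eq_bigr => i _; rewrite mxE.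
Qed.

Lemma continuous_quadratic (R : realType) (n : nat) (A : 'M[R]_n) :
  continuous (fun x : 'rV[R]_n => dotv x^T (A *m x^T)).
Proof.
rewrite [X in continuous X](_ : _ = fun x : 'rV[R]_n =>
    \sum_(i < n) x 0 i * dotv (row i A)^T x^T).
  apply: continuous_sum => i x.
  apply: (@continuousM _ _ (fun z : 'rV[R]_n => z 0 i)
    (fun z : 'rV[R]_n => dotv (row i A)^T z^T)); first exact: coord_continuous.
  exact: continuous_dotv.
apply/funext => z; rewrite dotvE; apply: eq_bigr => i _; rewrite !mxE.
by congr (_ * _); rewrite dotvE; apply: eq_bigr => j _; rewrite !mxE.
Qed.

(* Rayleigh quotients: the maximum of the quadratic form on the unit sphere of
   the orthogonal complement of v is attained at an eigenvector. *)
Lemma spectral_gap (R : realType) (n : nat) (U : 'M[R]_n.+1) (hU : U^T = U)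
    (lambda : R) (hlambda : largest_eigenvalue U lambda)
    (hdim : \rank (eigenspace U lambda) = 1%N)
    (v : 'cV[R]_n.+1) (hv : (v^T <= eigenspace U lambda)%MS) (hvS : fnorm v = 1) :
  exists2 mu, mu < lambda & forall z, dotv v z = 0 ->
    dotv z (U *m z) <= mu * fnorm z ^+ 2.
Proof.
pose S := [set x : 'rV[R]_n.+1 | dotv v x^T = 0 /\ fnorm x^T = 1].
have Uv : U *m v = lambda *: v.
  move/eigenspaceP : hv => H; apply: trmx_inj.
  by rewrite trmx_mul hU H linearZ.
(* If no unit vector is orthogonal to [v], then [z] is zero and any [mu] below [lambda] serves. *)
have [S0|S0] := pselect (S !=set0); last first.
  exists (lambda - 1); first by rewrite ltrBlDr ltrDl.
  move=> z vz; have [z0|z0] := eqVneq (fnorm z) 0.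
    have := norm_dotv_le U z z; rewrite z0 mul0r mulr0 normr_le0 => /eqP->.
    by rewrite expr0n mulr0.
  exfalso; apply: S0; exists (((fnorm z)^-1) *: z)^T; split; rewrite trmxK.
    by rewrite dotvZr vz mulr0.
  apply/eqP; rewrite -(@eqrXn2 _ 2) ?fnorm_ge0// expr1n -dotvv dotvZl dotvZr.
  by rewrite dotvv mulrA -expr2 -exprMn mulVf// expr1n.
have sqr1 (x : 'cV[R]_n.+1) : dotv x x = 1 <-> fnorm x = 1.
  rewrite dotvv; split => [|->]; last by rewrite expr1n.
  move=> /eqP; rewrite sqrf_eq1 => /orP[/eqP//|/eqP E].
  by have := fnorm_ge0 x; rewrite E; lra.
have cS : compact S.
  apply: bounded_closed_compact.
    exists 1; split => // M M1 x [_ x1] /=.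
    apply: le_trans (ltW M1); rewrite [leLHS]/Num.Def.normr/= mx_normrE.
    apply: bigmax_le => // -[i j] _ /=.
    by have := entry_le_fnorm x^T j i; rewrite x1 mxE.
  (* The unit-norm condition is a level set of the quadratic form of the identity, so its closedness
     follows from [continuous_quadratic]. *)
  rewrite (_ : S = (fun x : 'rV[R]_n.+1 => dotv v x^T) @^-1` [set 0] `&`
     (fun x : 'rV[R]_n.+1 => dotv x^T (1%:M *m x^T)) @^-1` [set 1]); last first.
    apply/seteqP; split => x [] /= ? x1; split => //; move: x1;
    by rewrite mul1mx sqr1.
  apply: closedI.
    apply: (proj1 (continuous_closedP _) (@continuous_dotv _ _ v)).
    exact: closed_eq.
  apply: (proj1 (continuous_closedP _) (@continuous_quadratic _ _ 1%:M)).
  exact: closed_eq.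
have [x xS xmax] := @compact_EVT_max _ _ (fun x : 'rV[R]_n.+1 =>
  dotv x^T (U *m x^T)) S S0 cS (continuous_subspaceT (@continuous_quadratic _ _ U)).
pose z0 := x^T; pose M := dotv z0 (U *m z0).
have [vz0 z01] : dotv v z0 = 0 /\ fnorm z0 = 1 by move: xS; rewrite inE.
have max z : dotv v z = 0 -> dotv z (U *m z) <= M * fnorm z ^+ 2.
  move=> vz; have [nz0|nz0] := eqVneq (fnorm z) 0.
    have := norm_dotv_le U z z; rewrite nz0 mul0r mulr0 normr_le0 => /eqP->.
    by rewrite expr0n mulr0.
  have := xmax (((fnorm z)^-1) *: z)^T; rewrite inE trmxK.
  have h : S (((fnorm z)^-1) *: z)^T.
    split; rewrite trmxK; first by rewrite dotvZr vz mulr0.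
    by apply/sqr1; rewrite dotvZl dotvZr dotvv mulrA -expr2 -exprMn mulVf// expr1n.
  move=> /(_ h); rewrite -/z0 -/M -scalemxAr dotvZl dotvZr mulrA -expr2 exprVn.
  by rewrite mulrC ler_pdivrMr// exprn_gt0// lt_neqAle eq_sym nz0 fnorm_ge0.
have sym a b : dotv a (U *m b) = dotv b (U *m a).
  by rewrite dotv_mulmx hU dotvC.
(* First-order condition at the maximiser: moving [z0] by [s *: w] gives [0 <= s * (s * D - 2 * B)]
   for every [s], which forces [B = 0]. *)
have orth w : dotv v w = 0 -> dotv w (U *m z0 - M *: z0) = 0.
  move=> vw; rewrite dotvBr dotvZr; set B := _ - _.
  pose D := M * fnorm w ^+ 2 - dotv w (U *m w).
  have H s : 0 <= s * (s * D - 2 * B).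
    have := max (z0 + s *: w); rewrite dotvDr dotvZr vz0 vw mulr0 addr0.
    move=> /(_ erefl); rewrite -!dotvv mulmxDr -scalemxAr.
    rewrite !(dotvDr, dotvDl) !(dotvZr, dotvZl) !dotvv z01 -/M (sym z0 w).
    rewrite (dotvC z0 w) => h; rewrite -subr_ge0 in h; apply: le_trans h _.
    by rewrite le_eqVlt; apply/orP; left; apply/eqP; rewrite /B /D -!dotvv; ring.
  apply/eqP/negP => /negP B0.
  (* For this [s] the product is s^2 (D - 2 (|D| + 1)) < 0, a contradiction. *)
  pose s := B / (`|D| + 1).
  have D1 : 0 < `|D| + 1 by apply: ltr_wpDl.
  have BE : B = s * (`|D| + 1) by rewrite /s mulfVK// gt_eqF.
  have s0 : s != 0 by apply: contraNneq B0 => s0; rewrite BE s0 mul0r.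
  have s20 : 0 < s ^+ 2 by rewrite exprn_even_gt0.
  have := H s; rewrite [X in 0 <= X](_ : _ = s ^+ 2 * (D - 2 * (`|D| + 1))).
    rewrite pmulr_rge0//; have := ler_norm D; have := normr_ge0 D; lra.
  by rewrite BE; ring.
have eigz : U *m z0 = M *: z0.
  apply/eqP; rewrite -subr_eq0.
  (* The residual is itself orthogonal to [v], as [U] is symmetric and [v] an eigenvector, so [orth]
     applied to the residual makes it vanish. *)
  set w := _ - _.
  have vw : dotv v w = 0.
    by rewrite dotvBr dotvZr vz0 mulr0 subr0 dotv_mulmx hU Uv dotvZl vz0 mulr0.
  have := orth w vw; rewrite -/w dotvv => /eqP; rewrite sqrf_eq0 => /eqP w0.
  by rewrite (fnorm_eq0 w0).
have z0row : (z0^T <= eigenspace U M)%MS.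
  by apply/eigenspaceP; rewrite -[in LHS]hU -trmx_mul eigz linearZ.
have z0n : z0 != 0.
  by apply: contra_eq_neq z01 => ->; rewrite fnorm0 eq_sym oner_neq0.
have eM : eigenvalue U M.
  apply/eigenvalueP; exists z0^T; first exact/eigenspaceP.
  by rewrite trmx_eq0.
exists M; last by [].
(* Were the maximum equal to [lambda], the nonzero [z0] would lie on the line spanned by [v] and yet
   be orthogonal to it. *)
rewrite lt_neqAle (proj2 hlambda)// andbT; apply/negP => /eqP ME.
have vn : v^T != 0.
  rewrite trmx_eq0; apply: contra_eq_neq hvS => ->.
  by rewrite fnorm0 eq_sym oner_neq0.
have Ev : (eigenspace U lambda <= v^T)%MS.
  have : (v^T == eigenspace U lambda)%MS.
    by rewrite -(geq_leqif (mxrank_leqif_eq hv)) hdim lt0n mxrank_eq0.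
  by move=> /andP[].
have : (z0^T <= v^T)%MS by apply: submx_trans Ev; rewrite -ME.
move=> /sub_rVP[a]; rewrite -linearZ => /trmx_inj z0E.
move: vz0; rewrite z0E dotvZr dotvv hvS expr1n mulr1 => a0.
by move: z0n; rewrite z0E a0 scale0r eqxx.
Qed.

(** * Monotonicity and comparison for absolutely continuous functions *)

Lemma sum_length_le_measure (R : realType) (O : set R) (m : nat)
    (a b : 'I_m -> R) :
  measurable O -> (forall k, a k <= b k) ->
  (forall k, `]a k, b k[%classic `<=` O) ->
  trivIset [set: 'I_m] (fun k => `]a k, b k[%classic) ->
  ((\sum_(k < m) (b k - a k))%:E <= lebesgue_measure O)%E.
Proof.
move=> mO ab abO tab.
have mab k : measurable (`]a k, b k[%classic : set R).
  exact: measurable_itv.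
have -> : ((\sum_(k < m) (b k - a k))%:E =
    lebesgue_measure (\big[setU/set0]_(k < m) `]a k, b k[%classic))%E.
  rewrite measure_bigsetU_ord// -sumEFin; apply: eq_bigr => k _ /=.
  rewrite lebesgue_measure_itv/= lte_fin.
  by case: ltP => // ba; rewrite (@le_anti _ _ (a k) (b k)) ?ab ?ba// subrr.
apply: le_measure; rewrite ?inE//; first exact: bigsetU_measurable.
by elim/big_ind: _ => // A B AO BO; rewrite subUset.
Qed.

(** The local step at the supremum of the points where [G] holds carries [G] from a point just
    before it to one beyond it, or to [d]. *)
Lemma real_induction (R : realType) (c d : R) (G : R -> Prop) : c <= d ->
  G c ->
  (forall x, c <= x -> x <= d -> exists2 r, 0 < r & forall s s',
     c <= s -> s <= x -> x <= s' -> s' <= d -> x - r < s -> s' < x + r ->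
     G s -> G s') ->
  G d.
Proof.
move=> cd Gc step.
pose S := [set t | [/\ c <= t, t <= d & G t]].
have Sc : S c by split.
have hS : has_sup S by split; [exists c|exists d => t []].
have cs : c <= sup S by exact: sup_upper_bound.
have sd : sup S <= d by apply: ge_sup; [exists c|move=> t []].
have [r r0 stp] := step _ cs sd.
have [t [ct td Gt] srt] := sup_adherent r0 hS.
have ts : t <= sup S by exact: sup_upper_bound.
have [sd'|] := ltP (sup S) d; last first.
  move=> ds; apply: (stp t) => //; lra.
pose s' := Num.min d (sup S + r / 2).
have s'd : s' <= d by rewrite /s' ge_min lexx.
have s's : sup S < s' by rewrite /s' lt_min sd' /=; lra.
have s'r : s' < sup S + r by rewrite /s' gt_min; apply/orP; right; lra.
have Gs' : G s' by apply: (stp t) => //; exact: ltW.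
have : s' <= sup S by apply: sup_upper_bound => //; split=> //; lra.
by rewrite leNgt s's.
Qed.

(** The Caratheodory slope at [x] is continuous with value [l >= 0], hence above [- e] nearby; it is
    used once on each side of [x]. *)
Lemma is_derive_ge0_local (R : realType) (f : R -> R) (x l e : R) :
  0 < e -> is_derive x 1 f l -> 0 <= l ->
  exists2 r, 0 < r & forall s s',
    s <= x -> x <= s' -> x - r < s -> s' < x + r ->
    f s - e * (s' - s) <= f s'.
Proof.
move=> e0 /is_derive1_caratheodory[g [fg cg gx]] l0.
have : \forall z \near x, - e < g z.
  by apply: (@cvgr_gt _ _ _ _ g (g x) cg); rewrite gx; lra.
move=> /nbhs_ballP[r /= r0 rg]; exists r => // s s' sx xs' xrs s'xr.
have gs : - e < g s by apply: rg; rewrite /ball/= ger0_norm; lra.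
have gs' : - e < g s'.
  by apply: rg; rewrite /ball/= distrC ger0_norm; lra.
have := fg s; have := fg s'; nra.
Qed.

(* Off the null set of bad points f grows at rate at least -e; on it, an open
   cover V of small measure turns the possible decrease into a sum of
   increments over disjoint subintervals of O, small by absolute continuity. *)
Lemma abs_continuous_ge0_le (R : realType) (f : R -> R) (c d : R) : c <= d ->
  abs_continuous c d f ->
  {ae @lebesgue_measure R, forall t : R, c < t -> t < d ->
    exists2 l, is_derive t 1 f l & 0 <= l} ->
  f c <= f d.
Proof.
move=> cd acf [N0 [mN0 N00 N0P]].
(* The endpoints join the null set, so that every point of [[c, d]] outside [N] has a nonnegative
   derivative. *)
pose N := N0 `|` [set c] `|` [set d].
have mNc : measurable (N0 `|` [set c]) by exact: measurableU.
have mN : measurable N by exact: measurableU.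
have N_0 : lebesgue_measure N = 0%E.
  rewrite measureU0//; last exact: lebesgue_measure_set1.
  by rewrite measureU0//; exact: lebesgue_measure_set1.
have NP t : c <= t -> t <= d -> ~ N t -> exists2 l, is_derive t 1 f l & 0 <= l.
  move=> ct td nN.
  have {}ct : c < t.
    by rewrite lt_neqAle ct andbT; apply/eqP => E; apply: nN; left; right.
  have {}td : t < d.
    by rewrite lt_neqAle td andbT; apply/eqP => E; apply: nN; right.
  apply: contrapT => nl; apply: nN; left; left; apply: N0P => /=.
  by move=> /(_ ct td).
(* Good points may cost [e * (d - c)] in total and bad points [e]; with [e / (d - c + 1)] the two
   losses add up to the given [e]. *)
suff H e : 0 < e -> f c - e * (d - c) - e <= f d.
  rewrite -subr_ge0; apply/ler_addgt0Pr => e e0.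
  have e1 : 0 < e / (d - c + 1) by apply: divr_gt0 => //; lra.
  have := H _ e1.
  suff : e / (d - c + 1) * (d - c) + e / (d - c + 1) = e by lra.
  by field; lra.
move=> e0; have [del del0 acd] := acf e e0.
have [V [oV NV muV]] : exists V : set R,
    [/\ open V, N `<=` V & (lebesgue_measure (V `\` N) < del%:E)%E].
  have Nfin : (lebesgue_measure N < +oo)%E by rewrite N_0.
  exact: (lebesgue_regularity_outer mN Nfin del0).
have mV : measurable V by exact: measurable_realfun.open_measurable.
have {}muV : (lebesgue_measure V < del%:E)%E.
  rewrite -(setDUK NV) setUC measureU0//; exact: measurableD.
(* [G t] is a certificate: an ordered list of disjoint intervals inside [V] whose increments pay for
   any loss up to [t] beyond slope [- e]. *)
pose G t := exists (m : nat) (a b : nat -> R),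
  [/\ forall k, (k < m)%N -> [/\ c <= a k, a k <= b k & b k <= t],
      forall k, (k < m)%N -> `]a k, b k[%classic `<=` V,
      forall j k, (j < k)%N -> (k < m)%N -> b j <= a k
    & f c - e * (t - c) - \sum_(k < m) `|f (b k) - f (a k)| <= f t].
have : G d.
  apply: (@real_induction _ c) => //.
    exists 0%N, (fun=> c), (fun=> c); split => //.
    by rewrite big_ord0 subrr mulr0 !subr0.
  (* Near a bad point the interval from [s] to [s'] lies in [V] and is appended to the list; near a
     good point the list is kept. *)
  move=> x cx xd; have [Nx|Nx] := pselect (N x).
    have /nbhs_ballP[r /= r0 rV] : nbhs x V by apply: open_nbhs_nbhs; split => //; exact: NV.
    exists r => // s s' cs sx xs' s'd xrs s'xr [m [a [b [ab abV sep Gs]]]].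
    exists m.+1, (fun k => if (k < m)%N then a k else s),
      (fun k => if (k < m)%N then b k else s'); split.
    - move=> k; rewrite ltnS => km; case: ifPn => // [/ab[? ? ?]|_];
        by split; lra.
    - move=> k; rewrite ltnS => km; case: ifPn => // [/abV//|_].
      move=> z /=; rewrite in_itv/= => /andP[sz zs'].
      by apply: rV; rewrite /ball/= ltr_distlC; lra.
    - move=> j k jk; rewrite ltnS => km.
      rewrite (leq_trans jk km); case: ifPn => // kltm; first exact: sep.
      by have [] := ab j (leq_trans jk km).
    - rewrite big_ord_recr/= ltnn.
      under eq_bigr do rewrite ltn_ord.
      have := ler_norm (f s - f s'); rewrite distrC.
      have : e * (s' - s) >= 0 by apply: mulr_ge0; lra.
      lra.
  have [l fl l0] := NP _ cx xd Nx.
  have [r r0 H] := is_derive_ge0_local e0 fl l0.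
  exists r => // s s' cs sx xs' s'd xrs s'xr [m [a [b [ab abV sep Gs]]]].
  exists m, a, b; split => //.
    by move=> k /ab[? ? ?]; split; lra.
  have := H s s' sx xs' xrs s'xr; lra.
move=> [m [a [b [ab abV sep Gd]]]].
have tab : trivIset [set: 'I_m] (fun k : 'I_m => `]a k, b k[%classic).
  apply/trivIsetP => i j _ _; wlog ij : i j / (i < j)%N.
    move=> H; rewrite neq_lt => /orP[] ij; first by rewrite H// neq_lt ij.
    by rewrite setIC H// neq_lt ij.
  move=> _; apply/seteqP; split => // z [] /=; rewrite !in_itv/=.
  move=> /andP[_ zb] /andP[az _].
  have := sep i j ij (ltn_ord j); lra.
have : \sum_(k < m) `|f (b k) - f (a k)| < e.
  apply: acd => //; first by move=> k; exact: ab.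
  rewrite -lte_fin; apply: le_lt_trans muV.
  apply: sum_length_le_measure => // k; last exact: abV.
  by have [] := ab k (ltn_ord k).
lra.
Qed.

Lemma ae_lebesgueS (R : realType) (P Q : R -> Prop) :
  (forall t, P t -> Q t) -> {ae @lebesgue_measure R, forall t, P t} ->
  {ae @lebesgue_measure R, forall t, Q t}.
Proof. by move=> PQ; apply: negligibleS => t; exact: contra_not (@PQ t). Qed.

Lemma abs_continuous_sub (R : realType) (V : normedModType R) (f : R -> V)
    (c d c' d' : R) :
  c <= c' -> d' <= d -> abs_continuous c d f -> abs_continuous c' d' f.
Proof.
move=> cc' dd' acf e e0; have [del del0 H] := acf e e0; exists del => // m a b ab.
by apply: H => k; have [? ? ?] := ab k; split; lra.
Qed.

Lemma abs_continuous_lipschitz (R : realType) (V : normedModType R)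
    (f : R -> V) (g : V -> R) (K c d : R) :
  (forall x y, `|g x - g y| <= K * `|x - y|) -> abs_continuous c d f ->
  abs_continuous c d (g \o f).
Proof.
move=> gK acf e e0; have K1 : 0 < `|K| + 1 by apply: ltr_wpDl.
have [|del del0 H] := acf (e / (`|K| + 1)); first exact: divr_gt0.
exists del => // m a b ab tab sab; have := H m a b ab tab sab.
rewrite ltr_pdivlMr//; apply: le_lt_trans; rewrite mulr_suml.
apply: ler_sum => k _; apply: le_trans (gK _ _) _; rewrite mulrC.
by apply: ler_wpM2l => //; have := ler_norm K; lra.
Qed.

Lemma abs_continuous_subZ (R : realType) (f : R -> R) (k c d : R) :
  0 < k -> abs_continuous c d f -> abs_continuous c d (fun t => f t - k * t).
Proof.
move=> k0 acf e e0; have [|del del0 H] := acf (e / 2); first by lra.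
exists (Num.min del (e / 2 / k)); first by rewrite lt_min del0 !divr_gt0.
move=> m a b ab tab; rewrite lt_min => /andP[/(H m a b ab tab) sf].
rewrite ltr_pdivlMr// mulr_suml => sab.
apply: (@le_lt_trans _ _ (\sum_(i < m) (`|f (b i) - f (a i)| +
    (b i - a i) * k))); last by rewrite big_split/=; lra.
apply: ler_sum => i _; have [_ abi _] := ab i.
rewrite (_ : _ - _ = (f (b i) - f (a i)) - (b i - a i) * k); last by ring.
apply: le_trans (ler_normB _ _) _; rewrite lerD2l ger0_norm//.
by apply: mulr_ge0; lra.
Qed.

Lemma abs_continuous_modulus (R : realType) (f : R -> R) (c d e : R) :
  abs_continuous c d f -> 0 < e -> exists2 del, 0 < del &
    forall x y, c <= x -> x <= y -> y <= d -> y - x < del -> `|f y - f x| < e.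
Proof.
move=> acf e0; have [del del0 H] := acf e e0; exists del => // x y cx xy yd yx.
have := H 1%N (fun=> x) (fun=> y); rewrite !big_ord1; apply => //.
by apply/trivIsetP => i j; rewrite !ord1.
Qed.

(** Just after the last time at which [f] is at least [m], continuity keeps [f] in the strip between
    [m'] and [m], where it cannot decrease; so it never falls below [m]. *)
Lemma abs_continuous_barrier (R : realType) (f : R -> R) (c d m' m : R) :
  c <= d -> m' < m -> abs_continuous c d f ->
  {ae @lebesgue_measure R, forall t : R, c < t -> t < d -> m' < f t -> f t < m ->
    exists2 l, is_derive t 1 f l & 0 <= l} ->
  m <= f c -> m <= f d.
Proof.
move=> cd mm' acf df mc; rewrite leNgt; apply/negP => fdm.
pose S := [set t | [/\ c <= t, t <= d & m <= f t]].
have hS : has_sup S by split; [exists c; split|exists d => t []].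
have cs : c <= sup S by apply: sup_upper_bound => //; split.
have sd : sup S <= d by apply: ge_sup; [exists c; split|move=> t []].
have ms : m <= f (sup S).
  apply/ler_addgt0Pr => e e0; have [del del0 H] := abs_continuous_modulus acf e0.
  have [t [ct td mt] st] := sup_adherent del0 hS.
  have ts : t <= sup S by apply: sup_upper_bound.
  have : `|f (sup S) - f t| < e by apply: H => //; lra.
  rewrite ltr_norml => /andP[]; lra.
have sS t : sup S < t -> t <= d -> f t < m.
  move=> st td; rewrite ltNge; apply/negP => mt.
  have : t <= sup S by apply: sup_upper_bound => //; split => //; lra.
  lra.
have sd' : sup S < d.
  by rewrite lt_neqAle sd andbT; apply/eqP => E; move: ms; rewrite E leNgt fdm.
have [|del del0 H] := abs_continuous_modulus (e := m - m') acf; first by lra.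
pose r := Num.min d (sup S + del / 2).
have rd : r <= d by rewrite /r ge_min lexx.
have sr : sup S < r by rewrite /r lt_min sd' /=; lra.
have rdel : r < sup S + del by rewrite /r gt_min; apply/orP; right; lra.
have : f (sup S) <= f r.
  apply: abs_continuous_ge0_le; first exact: ltW.
    by apply: abs_continuous_sub acf.
  apply: ae_lebesgueS df => t Ht st tr; apply: Ht; [lra|lra| |]; last by apply: sS; lra.
  have : `|f t - f (sup S)| < m - m' by apply: H; lra.
  rewrite ltr_norml => /andP[]; lra.
have := sS r sr rd; lra.
Qed.

(** Growth at rate [k] below [m] would eventually exceed the bound [B], so [m] is reached; from then
    on it is a barrier. *)
Lemma abs_continuous_eventually_ge (R : realType) (f : R -> R) (c m k B : R) :
  0 < k -> (forall T, c <= T -> abs_continuous c T f) ->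
  (forall t, c <= t -> f t <= B) ->
  {ae @lebesgue_measure R, forall t : R, c < t -> f t < m ->
    exists2 l, is_derive t 1 f l & k <= l} ->
  exists2 T, c <= T & forall t, T <= t -> m <= f t.
Proof.
move=> k0 acf fB df.
have [[T cT mT]|nT] := pselect (exists2 T, c <= T & m <= f T).
  exists T => // t Tt; apply: (@abs_continuous_barrier R f T t (m - 1) m) => //.
  - by lra.
  - by apply: abs_continuous_sub (acf t _) => //; lra.
  - apply: ae_lebesgueS df => s Hs Ts st _ sm.
    have [||l dl kl] := Hs => //; first lra.
    by exists l => //; lra.
exfalso.
have fm t : c <= t -> f t < m.
  by move=> ct; rewrite ltNge; apply/negP => mt; apply: nT; exists t.
(* At this time growth at rate [k] yields [f T >= B + k]. *)
pose T := c + (B - f c) / k + 1.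
have cT : c <= T.
  have : 0 <= (B - f c) / k by apply: divr_ge0; [have := fB c (lexx _); lra|lra].
  rewrite /T; lra.
have : f c - k * c <= f T - k * T.
  apply: (@abs_continuous_ge0_le R (fun t => f t - k * t)) => //.
    exact: abs_continuous_subZ (acf _ cT).
  apply: ae_lebesgueS df => t Ht ct tT; have [|l dl kl] := Ht ct; first by apply: fm; lra.
  exists (l - k); last by lra.
  apply: is_deriveB.
  rewrite -[X in is_derive _ _ _ X]mulr1; exact: is_deriveZ.
have -> : k * T = k * c + (B - f c) + k by rewrite /T; field; lra.
have := fB T cT; lra.
Qed.

(** * Linear functionals along vector-valued curves *)

Lemma entry_le_mx_norm (R : realType) (n : nat) (x : 'cV[R]_n) i :
  `|x i 0| <= `|x|.
Proof.
rewrite [leRHS]/Num.Def.normr/= mx_normrE; apply/bigmax_geP; right => /=.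
by exists (i, 0).
Qed.

Lemma norm_dotv_le_mx_norm (R : realType) (n : nat) (v x : 'cV[R]_n) :
  `|dotv v x| <= (\sum_(i < n) `|v i 0|) * `|x|.
Proof.
rewrite dotvE mulr_suml; apply: le_trans (ler_norm_sum _ _ _) _.
by apply: ler_sum => i _; rewrite normrM ler_wpM2l// entry_le_mx_norm.
Qed.

Lemma abs_continuous_dotv (R : realType) (n : nat) (v : 'cV[R]_n.+1)
    (g : R -> 'cV[R]_n.+1) (c d : R) :
  abs_continuous c d g -> abs_continuous c d (fun t => dotv v (g t)).
Proof.
apply: (@abs_continuous_lipschitz _ _ g (dotv v) (\sum_(i < n.+1) `|v i 0|)).
by move=> x y; rewrite -dotvBr norm_dotv_le_mx_norm.
Qed.

Lemma is_derive_dotv (R : realType) (n : nat) (v : 'cV[R]_n.+1)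
    (g : R -> 'cV[R]_n.+1) (t : R) (l : 'cV[R]_n.+1) :
  is_derive t 1 g l -> is_derive t 1 (fun s => dotv v (g s)) (dotv v l).
Proof.
move=> [dg gl].
have H : h^-1 *: (((fun s => dotv v (g s)) \o shift t) (h *: 1) - dotv v (g t))
    @[h --> 0^'] --> dotv v l.
  have : h^-1 *: ((g \o shift t) (h *: 1) - g t) @[h --> 0^'] --> l.
    by rewrite -gl; exact: dg.
  move=> /cvgrPdist_lt gcv; apply/cvgrPdist_lt => e e0.
  set K := \sum_(i < n.+1) `|v i 0|.
  have K0 : 0 <= K by apply: sumr_ge0.
  have := gcv (e / (K + 1)); rewrite divr_gt0//; last lra.
  move=> /(_ isT); apply: filterS => h /=; rewrite ltr_pdivlMr; last lra.
  rewrite -dotvBr (_ : h^-1 *: dotv v _ = dotv v (h^-1 *: (g (h%:A + t) - g t)));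
    last by rewrite dotvZr.
  rewrite -dotvBr; apply: le_lt_trans.
  apply: le_trans (norm_dotv_le_mx_norm _ _) _; rewrite mulrC.
  by apply: ler_wpM2l => //; rewrite -/K; lra.
by split; [apply/cvg_ex; exists (dotv v l)|exact: cvg_lim H].
Qed.

(** * The cosines of the tokens with the leading eigenvector *)

Lemma sum_le_card (R : realType) (m : nat) (p : pred 'I_m) (G : 'I_m -> R)
    (D : R) : 0 <= D -> (forall j, p j -> G j <= D) ->
  \sum_(j < m | p j) G j <= m%:R * D.
Proof.
move=> D0 GD; apply: (@le_trans _ _ (\sum_(j < m | p j) D)); first exact: ler_sum.
rewrite sumr_const -[leLHS]mulr_natl ler_wpM2r// ler_nat.
by rewrite -[leqRHS]card_ord max_card.
Qed.

Section AutoRegressiveAttention.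
Variables (R : realType) (n l : nat) (U : 'M[R]_n.+1) (P : R -> 'M[R]_n.+1).
Variables (lambda mu B : R) (v : 'cV[R]_n.+1).
Hypotheses (hU : U^T = U) (Uv : U *m v = lambda *: v) (v1 : fnorm v = 1).
Hypotheses (lambda0 : 0 < lambda) (mulambda : mu < lambda).
Hypothesis (gap : forall z, dotv v z = 0 ->
  dotv z (U *m z) <= mu * fnorm z ^+ 2).
Hypothesis (hP : forall t : R, 0 <= t -> fnorm (P t) <= B).

Implicit Types (y : state R n l.+1) (i j : 'I_l.+1) (x z : 'cV[R]_n.+1).

Let S := sphere_prod R n l.+1.
Let F : R -> state R n l.+1 -> state R n l.+1 := attn_field U P.
Let proj x := x - dotv v x *: v.
(** [K] bounds the bilinear form of [U] and [C] the exponents of the scores on the sphere. [wmin] is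
    the resulting lower bound of the weights: score at least exp(-C), sum of at most [l.+1] scores
    each at most exp(C). *)
Let K : R := (n.+1 * n.+1)%:R * fnorm U.
Let C : R := (n.+1 * n.+1)%:R * B.
Let wmin : R := (expR C * (Num.sqrt n.+1%:R * (l.+1%:R * expR C)))^-1.

Lemma dotv_proj x : dotv v (proj x) = 0.
Proof. by rewrite dotvBr dotvZr dotvv v1 expr1n mulr1 subrr. Qed.

Lemma sqr_fnorm_proj x : fnorm x = 1 -> fnorm (proj x) ^+ 2 = 1 - dotv v x ^+ 2.
Proof.
move=> x1; rewrite -dotvv [in X in dotv X _]/proj dotvBl dotvZl dotv_proj.
rewrite mulr0 subr0 /proj dotvBr dotvZr dotvv x1 (dotvC x v); ring.
Qed.

Lemma dotv_le1 x : fnorm x = 1 -> dotv v x <= 1.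
Proof.
by move=> /sqr_fnorm_proj h; have := sqr_ge0 (fnorm (proj x)); rewrite h; nra.
Qed.

Lemma dotv_vU x : dotv v (U *m x) = lambda * dotv v x.
Proof. by rewrite dotv_mulmx hU Uv dotvZl. Qed.

(** The cross terms vanish: symmetry of [U] makes the orthogonal complement of [v] invariant. *)
Lemma dotv_split x z :
  dotv x (U *m z) = lambda * dotv v x * dotv v z + dotv (proj x) (U *m proj z).
Proof.
rewrite /proj mulmxBr -scalemxAr Uv !(dotvBr, dotvBl, dotvZr, dotvZl) dotv_vU.
by rewrite dotvv v1 (dotvC x v); ring.
Qed.

Lemma quadratic_le x : fnorm x = 1 ->
  dotv x (U *m x) <= lambda - (lambda - mu) * (1 - dotv v x ^+ 2).
Proof.
move=> x1; rewrite dotv_split; have := gap (dotv_proj x).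
by rewrite sqr_fnorm_proj//; lra.
Qed.

Lemma form_bound_ge0 : 0 <= K.
Proof. by rewrite mulr_ge0// fnorm_ge0. Qed.

Lemma dotv_U_le x z : fnorm x <= 1 -> `|dotv x (U *m z)| <= K * fnorm z.
Proof.
move=> x1; apply: le_trans (norm_dotv_le _ _ _) _; rewrite -/K.
by rewrite ler_wpM2l ?form_bound_ge0// ler_piMl// fnorm_ge0.
Qed.

Lemma dotv_attn_field (t : R) y i :
  dotv v (F t y i) = \sum_(j < l.+1 | (j <= i)%N) attn_weight (P t) y i j *
    (lambda * dotv v (y j) - dotv v (y i) * dotv (y i) (U *m y j)).
Proof.
rewrite /F /attn_field; set s := \sum_(_ < _ | _) _.
have -> : (1%:M - y i *m (y i)^T) *m s = s - dotv (y i) s *: y i.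
  rewrite mulmxBl mul1mx -mulmxA; congr (_ - _).
  by rewrite [_^T *m _]mx11_scalar mul_mx_scalar.
rewrite dotvBr dotvZr /s !dotv_sumr mulr_suml -sumrB.
by apply: eq_bigr => j _; rewrite !dotvZr dotv_vU; ring.
Qed.

Lemma attn_score_bounds (t : R) y i j : 0 <= t -> S y ->
  expR (- C) <= attn_score (P t) y i j <= expR C.
Proof.
move=> t0 Sy; rewrite /attn_score !ler_expR -ler_norml -mulmxA.
apply: le_trans (norm_dotv_le (P t) (y i) (y j)) _.
by rewrite (Sy i) (Sy j) !mulr1 ler_wpM2l// hP.
Qed.

Lemma weight_bound_gt0 : 0 < wmin.
Proof. by rewrite invr_gt0 !mulr_gt0 ?expR_gt0 ?sqrtr_gt0. Qed.

Lemma attn_weight_bounds (t : R) y i j : 0 <= t -> S y -> (j <= i)%N ->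
  wmin <= attn_weight (P t) y i j <= 1.
Proof.
move=> t0 Sy ji; have sb k := attn_score_bounds i k t0 Sy.
rewrite /attn_weight; set s := \sum_(_ < _ | _) _.
have s0 k : 0 < attn_score (P t) y i k by exact: expR_gt0.
have js : attn_score (P t) y i j <= s.
  by rewrite /s (bigD1 j)//= lerDl; apply: sumr_ge0 => k _; exact: ltW.
have sC : s <= l.+1%:R * expR C.
  by apply: sum_le_card => [|k _]; [exact: expR_ge0|have /andP[] := sb k].
have ss : 0 < s by exact: lt_le_trans js.
have r1 : 1 <= Num.sqrt n.+1%:R :> R.
  by rewrite -[leLHS]sqrtr1 ler_wsqrtr// ler1n.
have r0 : 0 < Num.sqrt n.+1%:R :> R by exact: lt_le_trans r1.
apply/andP; split; last first.
  rewrite ler_pdivrMr ?mulr_gt0// mul1r (le_trans js)//.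
  by rewrite ler_peMl// ltW.
rewrite /wmin invfM; apply: ler_pM.
- by rewrite invr_ge0 expR_ge0.
- by rewrite invr_ge0 !mulr_ge0 ?sqrtr_ge0 ?expR_ge0.
- by rewrite -expRN; have /andP[] := sb j.
- by rewrite lef_pV2 ?posrE ?mulr_gt0 ?expR_gt0// ler_wpM2l// ltW.
Qed.

(** Pattern of the drift estimates: the first token supplies the gain [A], and each of at most
    [l.+1] terms loses at most [D]. *)
Lemma sum_ge_first (G : 'I_l.+1 -> R) (A D : R) i : 0 <= D ->
  A - D <= G ord0 -> (forall j, (j <= i)%N -> - D <= G j) ->
  A - l.+1%:R * D <= \sum_(j < l.+1 | (j <= i)%N) G j.
Proof.
move=> D0 G0 Gj.
have : A <= \sum_(j < l.+1 | (j <= i)%N) (G j + D).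
  rewrite (bigD1 ord0)//=; apply: (@le_trans _ _ (G ord0 + D)); first lra.
  by rewrite lerDl; apply: sumr_ge0 => j /andP[/Gj]; lra.
have := @sum_le_card R l.+1 (fun j => (j <= i)%N) (fun=> D) D D0 (fun _ _ => lexx D).
by rewrite big_split/=; lra.
Qed.

(** * Lower bounds for the drift of the cosines *)

Lemma drift_first_ge0 (t : R) y : 0 <= t -> S y -> 0 <= dotv v (y ord0) ->
  0 <= dotv v (F t y ord0).
Proof.
(* The first token attends only to itself, and its Rayleigh quotient is at most [lambda]. *)
move=> t0 Sy c0; rewrite dotv_attn_field; apply: sumr_ge0 => j.
rewrite leqn0 => /eqP j0; have -> : j = ord0 by exact: val_inj.
have /andP[a0 _] := attn_weight_bounds t0 Sy (leqnn (@ord0 l)).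
apply: mulr_ge0; first by apply: le_trans a0; exact: ltW weight_bound_gt0.
have := quadratic_le (Sy ord0); have := sqr_fnorm_proj (Sy ord0).
have := sqr_ge0 (fnorm (proj (y ord0))).
move=> p0 pE; rewrite pE in p0.
have h : 0 <= (lambda - mu) * (1 - dotv v (y ord0) ^+ 2).
  by apply: mulr_ge0 => //; rewrite subr_ge0 ltW.
by move=> q; rewrite mulrC -mulrBr; apply: mulr_ge0 => //; lra.
Qed.

(** Every negative contribution carries the factor [dotv v (y i)], whereas the first token
    contributes at least [wmin * (lambda * b0)]; the latter wins when that factor is small. *)
Lemma drift_near0_ge0 (b0 : R) : 0 < b0 -> exists2 b, 0 < b &
  forall (t : R) y i, 0 <= t -> S y -> (0 < i)%N -> b0 <= dotv v (y ord0) ->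
    (forall j, (j < i)%N -> 0 <= dotv v (y j)) ->
    0 < dotv v (y i) -> dotv v (y i) < b -> 0 <= dotv v (F t y i).
Proof.
move=> b00; have K1 : 0 < l.+1%:R * (K + 1).
  by rewrite mulr_gt0//; have := form_bound_ge0; lra.
have A0 : 0 < wmin * (lambda * b0) by rewrite !mulr_gt0// weight_bound_gt0.
(* The threshold at which the total loss equals the gain; [K + 1] keeps the divisor positive. *)
exists (wmin * (lambda * b0) / (l.+1%:R * (K + 1))); first exact: divr_gt0.
move=> t y i t0 Sy i0 c0 cj ci; rewrite ltr_pdivlMr// => cib.
have K0 := form_bound_ge0.
rewrite dotv_attn_field.
have D0 : 0 <= dotv v (y i) * (K + 1) by apply: mulr_ge0; lra.
have qj j : dotv v (y i) * dotv (y i) (U *m y j) <= dotv v (y i) * (K + 1).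
  rewrite ler_pM2l//; have := @dotv_U_le (y i) (y j); rewrite (Sy i) (Sy j).
  by move=> /(_ (lexx _)); rewrite ler_norml => /andP[]; lra.
have aj j : (j <= i)%N -> 0 <= attn_weight (P t) y i j <= 1.
  move=> ji; have /andP[aw ->] := attn_weight_bounds t0 Sy ji.
  by rewrite andbT (le_trans _ aw)// ltW// weight_bound_gt0.
have cji j : (j <= i)%N -> 0 <= dotv v (y j).
  rewrite leq_eqVlt => /orP[/eqP/val_inj->|/cj//]; exact: ltW.
apply: le_trans (sum_ge_first (A := wmin * (lambda * b0)) D0 _ _).
- by move: cib; rewrite mulrCA; lra.
- have /andP[a0 a1] := attn_weight_bounds t0 Sy (ltnW i0 : (@ord0 l <= i)%N).
  have h1 : wmin * (lambda * b0) <=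
      attn_weight (P t) y i ord0 * (lambda * dotv v (y ord0)).
    apply: ler_pM => //; first exact: ltW weight_bound_gt0.
      by apply: mulr_ge0; exact: ltW.
    by rewrite ler_wpM2l// ltW.
  have /andP[a0' _] := aj ord0 (ltnW i0).
  have := qj ord0; nra.
- move=> j ji; have /andP[a0 a1] := aj j ji; have := qj j; have := cji j ji.
  move=> cj0 qq; have h : 0 <= lambda * dotv v (y j) by apply: mulr_ge0 => //; exact: ltW.
  nra.
Qed.

Lemma drift_ge (b0 eps : R) : 0 < b0 -> 0 < eps ->
  exists eta k : R, [/\ 0 < eta, 0 < k &
  forall (t : R) y i, 0 <= t -> S y -> b0 <= dotv v (y ord0) ->
    (forall j, 0 <= dotv v (y j)) ->
    (forall j, (j < i)%N -> 1 - eta <= dotv v (y j)) ->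
    dotv v (y i) <= 1 - eps -> k <= dotv v (F t y i)].
Proof.
move=> b00 eps0; have K0 := form_bound_ge0.
(* The first token's term gains through [lambda - mu] when [i] is that token, and through [lambda]
   otherwise. *)
pose g := Num.min lambda (lambda - mu).
have g0 : 0 < g by rewrite lt_min lambda0 subr_gt0.
pose A := wmin * (b0 * g * eps).
have A0 : 0 < A by rewrite !mulr_gt0// weight_bound_gt0.
have L0 : 0 < l.+1%:R * (K + 1) by rewrite mulr_gt0//; lra.
(* Orthogonal components of norm at most [q] cause a total error of at most [A / 2]. A cosine c >= 1
   - q^2 / 2 ensures this bound, since 1 - c^2 <= 2 (1 - c). *)
pose q := A / 2 / (l.+1%:R * (K + 1)).
have q0 : 0 < q by rewrite !divr_gt0.
exists (q ^+ 2 / 2), (A / 2); split; rewrite ?divr_gt0 ?exprn_gt0//.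
move=> t y i t0 Sy c0 cj0 cj ci.
have aj j : (j <= i)%N -> 0 <= attn_weight (P t) y i j <= 1.
  move=> ji; have /andP[aw ->] := attn_weight_bounds t0 Sy ji.
  by rewrite andbT (le_trans _ aw)// ltW// weight_bound_gt0.
rewrite dotv_attn_field.
have c1 j : dotv v (y j) <= 1 by apply: dotv_le1; exact: Sy.
have s0 : eps <= 1 - dotv v (y i) ^+ 2 by have := cj0 i; nra.
have D0 : 0 <= (K + 1) * q by apply: mulr_ge0; lra.
have term j : (j < i)%N ->
    lambda * dotv v (y j) * (1 - dotv v (y i) ^+ 2) - (K + 1) * q <=
    lambda * dotv v (y j) - dotv v (y i) * dotv (y i) (U *m y j).
  move=> ji; rewrite dotv_split.
  have pj : fnorm (proj (y j)) <= q.
    rewrite -(@ler_pXn2r _ 2) ?nnegrE ?fnorm_ge0 ?(ltW q0)//.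
    rewrite sqr_fnorm_proj; last exact: Sy.
    by have := cj j ji; have := cj0 j; have := c1 j; nra.
  have pi1 : fnorm (proj (y i)) <= 1.
    rewrite -(@ler_pXn2r _ 2) ?nnegrE ?fnorm_ge0//.
    rewrite sqr_fnorm_proj; last exact: Sy.
    by have := sqr_ge0 (dotv v (y i)); lra.
  have := dotv_U_le (proj (y j)) pi1; set p := dotv (proj _) _.
  move=> pK; have {}pK : `|p| <= (K + 1) * q.
    apply: le_trans pK _; apply: ler_pM => //; first exact: fnorm_ge0.
    by lra.
  have : dotv v (y i) * p <= (K + 1) * q.
    apply: le_trans pK; apply: le_trans (ler_norm _) _.
    by rewrite normrM ler_piMl// ger0_norm ?cj0.
  lra.
have self : dotv v (y i) * ((lambda - mu) * (1 - dotv v (y i) ^+ 2)) <=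
    lambda * dotv v (y i) - dotv v (y i) * dotv (y i) (U *m y i).
  rewrite [lambda * _]mulrC -mulrBr ler_wpM2l ?cj0//.
  by have := quadratic_le (Sy i); lra.
have gl : g <= lambda by rewrite ge_min lexx.
have gm : g <= lambda - mu by rewrite ge_min lexx orbT.
apply: le_trans (sum_ge_first (A := A) D0 _ _).
- have -> : l.+1%:R * ((K + 1) * q) = A / 2.
    by rewrite mulrA mulrC /q mulfVK// gt_eqF.
  lra.
- have /andP[a0 a1] := attn_weight_bounds t0 Sy (leq0n i : (@ord0 l <= i)%N).
  have /andP[a0' _] := aj ord0 (leq0n i).
  (* The weight lies between [wmin] and 1: it keeps a share [wmin] of the gain and does not enlarge
     the error. *)
  have key s : b0 * g * eps - (K + 1) * q <= s ->
      A - (K + 1) * q <= attn_weight (P t) y i ord0 * s.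
    move=> h; apply: (@le_trans _ _
      (attn_weight (P t) y i ord0 * (b0 * g * eps - (K + 1) * q))).
      rewrite mulrBr lerB//; last by rewrite ler_piMl.
      by rewrite /A ler_wpM2r// !mulr_ge0// ltW.
    by rewrite ler_wpM2l.
  apply: key; have [i0|i0] := posnP i.
    have iE : i = ord0 by exact: val_inj.
    rewrite iE in self s0 *; apply: le_trans self.
    apply: (@le_trans _ _ (b0 * g * eps)); first lra.
    rewrite -mulrA; apply: ler_pM => //; [exact: ltW|by rewrite mulr_ge0 ?ltW|].
    by apply: ler_pM => //; exact: ltW.
  apply: le_trans (term ord0 i0); rewrite lerB// -mulrA mulrCA -mulrA.
  apply: ler_pM => //; [exact: ltW|by rewrite mulr_ge0 ?ltW|].
  by apply: ler_pM => //; exact: ltW.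
- move=> j ji; have /andP[a0 a1] := aj j ji.
  have h : - ((K + 1) * q) <=
      lambda * dotv v (y j) - dotv v (y i) * dotv (y i) (U *m y j).
    move: ji; rewrite leq_eqVlt => /orP[/eqP/val_inj->|ji].
      by apply: le_trans self; apply: (@le_trans _ _ 0); [lra|
        rewrite !mulr_ge0//; lra].
    apply: le_trans (term j ji).
    have : 0 <= lambda * dotv v (y j) * (1 - dotv v (y i) ^+ 2).
      by rewrite !mulr_ge0//; lra.
    lra.
  nra.
Qed.

(** * Cosines along solutions: positivity, stability and attraction *)

Lemma solution_derive (y : R -> state R n l.+1) (i : 'I_l.+1) : is_solution S F y ->
  {ae @lebesgue_measure R, forall t : R, 0 < t ->
    is_derive t 1 (fun s => dotv v (y s i)) (dotv v (F t (y t) i))}.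
Proof.
move=> [_ _ dy]; apply: ae_lebesgueS dy => t dt t0.
by apply: is_derive_dotv; exact: dt.
Qed.

Lemma solution_abs_continuous (y : R -> state R n l.+1) (i : 'I_l.+1) (c d : R) :
  is_solution S F y -> 0 <= c -> c <= d ->
  abs_continuous c d (fun t => dotv v (y t i)).
Proof.
move=> [_ acy _] c0 cd; apply: abs_continuous_dotv.
by apply: abs_continuous_sub (acy i d _) => //; exact: le_trans cd.
Qed.

Lemma solution_first_ge (y : R -> state R n l.+1) (t : R) : is_solution S F y ->
  0 < dotv v (y 0 ord0) -> 0 <= t -> dotv v (y 0 ord0) <= dotv v (y t ord0).
Proof.
move=> sy c0 t0.
apply: (@abs_continuous_barrier R (fun s => dotv v (y s ord0)) 0 t 0) => //.
  exact: solution_abs_continuous.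
apply: ae_lebesgueS (solution_derive ord0 sy) => s ds s0 _ cs _.
exists (dotv v (F s (y s) ord0)); first exact: ds.
by have [Sy _ _] := sy; apply: drift_first_ge0; rewrite ?ltW//; exact: Sy (ltW s0).
Qed.

(** Strong induction on the token: with the earlier cosines positive and the first one above its
    initial value, [drift_near0_ge0] makes a small positive level a barrier. *)
Lemma solution_gt0 (y : R -> state R n l.+1) : is_solution S F y ->
  (forall i, 0 < dotv v (y 0 i)) ->
  forall i (t : R), 0 <= t -> 0 < dotv v (y t i).
Proof.
move=> sy y0 i; have [m] := ubnP (nat_of_ord i).
elim: m i => // m IH i; rewrite ltnS => im t t0.
have first s : 0 <= s -> dotv v (y 0 ord0) <= dotv v (y s ord0).
  by apply: solution_first_ge.
have [i0|i0] := posnP i.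
  have -> : i = ord0 by exact: val_inj.
  exact: lt_le_trans (y0 ord0) (first t t0).
have [b b0 H] := drift_near0_ge0 (y0 ord0).
pose m0 := Num.min (dotv v (y 0 i)) b.
have m00 : 0 < m0 by rewrite lt_min y0.
apply: (lt_le_trans m00).
apply: (@abs_continuous_barrier R (fun s => dotv v (y s i)) 0 t 0) => //.
- exact: solution_abs_continuous.
- apply: ae_lebesgueS (solution_derive i sy) => s ds s0 _ cs csm.
  exists (dotv v (F s (y s) i)); first exact: ds.
  have [Sy _ _] := sy; apply: H => //; [exact: ltW|exact: Sy (ltW s0)| | |].
  + by apply: first; exact: ltW.
  + by move=> j ji; apply/ltW/IH; [exact: leq_trans im|exact: ltW].
  + by move: csm; rewrite lt_min => /andP[].
- by rewrite ge_min lexx.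
Qed.

(** Induction on the number [m] of controlled tokens: once the earlier ones stay within [eta], the
    level [1 - eps] is a barrier for the next. *)
Lemma solution_stable (m : nat) (eps : R) : 0 < eps -> exists2 del, 0 < del &
  forall y : R -> state R n l.+1, is_solution S F y -> (forall i, 0 < dotv v (y 0 i)) ->
    2^-1 <= dotv v (y 0 ord0) -> (forall i, 1 - del <= dotv v (y 0 i)) ->
    forall (i : 'I_l.+1) (t : R), (i < m)%N -> 0 <= t ->
      1 - eps <= dotv v (y t i).
Proof.
elim: m eps => [eps _|m IH eps eps0]; first by exists 1.
have h2 : 0 < 2^-1 :> R by rewrite invr_gt0.
(* The fixed bound 1/2 on the first cosine makes [eta], hence [del], independent of the solution. *)
have [eta [k [eta0 k0 H]]] := drift_ge h2 eps0.
have [|del del0 Hdel] := IH (Num.min eta eps); first by rewrite lt_min eta0.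
exists (Num.min del eps); first by rewrite lt_min del0.
move=> y sy y0 yh yd i t; rewrite ltnS leq_eqVlt => im t0.
have prev j s : (j < m)%N -> 0 <= s -> 1 - Num.min eta eps <= dotv v (y s j).
  apply: Hdel => // h; apply: le_trans (yd h); rewrite lerD2l lerN2.
  by rewrite ge_min lexx.
case/orP: im => [/eqP im|im]; last first.
  by apply: le_trans (prev i t im t0); rewrite lerD2l lerN2 ge_min lexx orbT.
apply: (@abs_continuous_barrier R (fun s => dotv v (y s i)) 0 t (- eps)) => //.
- by rewrite -subr_gt0; lra.
- exact: solution_abs_continuous.
- apply: ae_lebesgueS (solution_derive i sy) => s ds s0 _ _ cs.
  exists (dotv v (F s (y s) i)); first exact: ds.
  have [Sy _ _] := sy; apply: le_trans (ltW k0) _.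
  apply: H; [exact: ltW|exact: Sy (ltW s0)| | | |exact: ltW].
  + by apply: (le_trans yh); apply: solution_first_ge => //; exact: ltW.
  + by move=> j; apply/ltW/solution_gt0 => //; exact: ltW.
  + move=> j; rewrite im => jm; apply: le_trans (prev j s jm (ltW s0)).
    by rewrite lerD2l lerN2 ge_min lexx.
- by apply: le_trans (yd i); rewrite lerD2l lerN2 ge_min lexx orbT.
Qed.

(** After the earlier tokens have come within [eta], the next cosine grows at rate at least [k]
    until it reaches [1 - eps]. Here [eta] and [k] may depend on the solution through its initial
    first cosine. *)
Lemma solution_attracted (y : R -> state R n l.+1) (m : nat) (eps : R) : is_solution S F y ->
  (forall i, 0 < dotv v (y 0 i)) -> 0 < eps ->
  exists2 T : R, 0 <= T & forall (i : 'I_l.+1) (t : R), (i < m)%N -> T <= t ->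
    1 - eps <= dotv v (y t i).
Proof.
move=> sy y0; elim: m eps => [eps _|m IH eps eps0]; first by exists 0.
have [eta [k [eta0 k0 H]]] := drift_ge (y0 ord0) eps0.
have [|T0 T00 prev] := IH (Num.min eta eps); first by rewrite lt_min eta0.
have [lm|ml] := leqP l.+1 m.
  exists T0 => // i t _ Tt; apply: le_trans (prev i t _ Tt).
    by rewrite lerD2l lerN2 ge_min lexx orbT.
  exact: leq_trans lm.
pose i := Ordinal ml; have [Sy _ _] := sy.
have [|||T T0T HT] := @abs_continuous_eventually_ge R
    (fun s => dotv v (y s i)) T0 (1 - eps) k 1 k0.
- by move=> T T0T; exact: solution_abs_continuous.
- by move=> t T0t; apply: dotv_le1; apply: Sy; exact: le_trans T0t.
- apply: ae_lebesgueS (solution_derive i sy) => s ds T0s cs.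
  have s0 : 0 < s by exact: le_lt_trans T0s.
  exists (dotv v (F s (y s) i)); first exact: ds.
  apply: H; [exact: ltW|exact: Sy (ltW s0)| | | |exact: ltW].
  + by apply: solution_first_ge => //; exact: ltW.
  + by move=> j; apply/ltW/solution_gt0 => //; exact: ltW.
  + move=> j jm; apply: le_trans (prev j s jm (ltW T0s)).
    by rewrite lerD2l lerN2 ge_min lexx.
exists T; first exact: le_trans T0T.
move=> j t; rewrite ltnS leq_eqVlt => /orP[/eqP jm|jm] Tt.
  by have -> : j = i; [exact: val_inj|exact: HT].
apply: le_trans (prev j t jm _); last exact: le_trans Tt.
by rewrite lerD2l lerN2 ge_min lexx orbT.
Qed.

(** * From cosines to distances, and conclusion *)

Lemma sqr_fnormB x : fnorm x = 1 -> fnorm (x - v) ^+ 2 = 2 * (1 - dotv v x).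
Proof.
move=> x1; rewrite -dotvv !(dotvBr, dotvBl) !dotvv x1 v1 (dotvC x v); ring.
Qed.

Lemma state_dist_lt (y : state R n l.+1) (e : R) : 0 < e -> S y ->
  (forall i, 1 - e ^+ 2 / (4 * l.+1%:R) <= dotv v (y i)) ->
  state_dist y (fun=> v) < e.
Proof.
move=> e0 Sy H; rewrite /state_dist -[ltRHS]ger0_norm ?ltW// -sqrtr_sqr.
rewrite ltr_sqrt ?exprn_gt0//.
have L0 : l.+1%:R != 0 :> R by rewrite pnatr_eq0.
have quarter (L : R) : L != 0 -> 2 * (e ^+ 2 / (4 * L)) = e ^+ 2 / (2 * L).
  by move=> ?; field.
have half (L : R) : L != 0 -> L * (e ^+ 2 / (2 * L)) = e ^+ 2 / 2.
  by move=> ?; field.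
(* The factor 4 in the hypothesis makes the squared distance at most [e ^+ 2 / 2], which leaves room
   for strictness. *)
apply: (@le_lt_trans _ _ (l.+1%:R * (e ^+ 2 / (2 * l.+1%:R)))).
  apply: sum_le_card => [|i _]; first by rewrite divr_ge0// sqr_ge0.
  rewrite (sqr_fnormB (Sy i)).
  rewrite -(quarter _ L0).
  by rewrite ler_pM2l// lerBlDr addrC -lerBlDr.
rewrite (half _ L0).
by have : 0 < e ^+ 2; [rewrite exprn_gt0|lra].
Qed.

Lemma state_dist_ge (y : state R n l.+1) (d : R) (i : 'I_l.+1) : 0 < d -> S y ->
  state_dist y (fun=> v) < d -> 1 - d ^+ 2 / 2 <= dotv v (y i).
Proof.
move=> d0 Sy yd.
have : state_dist y (fun=> v) ^+ 2 < d ^+ 2.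
  by rewrite ltr_pXn2r ?nnegrE ?sqrtr_ge0// ltW.
rewrite sqr_sqrtr; last by apply: sumr_ge0 => *; exact: sqr_ge0.
rewrite (bigD1 i)//= (sqr_fnormB (Sy i)).
set r := \sum_(_ < _ | _) _; have : 0 <= r by apply: sumr_ge0 => *; exact: sqr_ge0.
lra.
Qed.

Lemma equilibrium_diag : is_equilibrium S F (fun=> v).
Proof.
split=> [i|t t0 i]; first exact: v1.
rewrite /F /attn_field; under eq_bigr do rewrite Uv.
rewrite -scaler_suml -!scalemxAr mulmxBl mul1mx -mulmxA.
have -> : v^T *m v = 1%:M.
  by rewrite [LHS]mx11_scalar -[_ 0 0]/(dotv v v) dotvv v1 expr1n.
by rewrite mulmx1 subrr !scaler0.
Qed.

Lemma hemisphere_attracted :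
  open_hemisphere_prod v `<=` domain_of_attraction S F (fun=> v).
Proof.
move=> y0 [Sy0 cy0]; split=> // y sy yE; have [Sy _ _] := sy.
have c0 i : 0 < dotv v (y 0 i) by rewrite yE.
apply/cvgrPdist_lt => e e0.
have [|T T0 HT] := @solution_attracted y l.+1 (e ^+ 2 / (4 * l.+1%:R)) sy c0.
  by rewrite divr_gt0// exprn_gt0.
exists T; split; first exact: num_real.
move=> t Tt; rewrite sub0r normrN ger0_norm; last exact: sqrtr_ge0.
apply: state_dist_lt => //; first by apply: Sy; rewrite (le_trans T0)// ltW.
by move=> i; apply: HT => //; exact: ltW.
Qed.

Lemma diag_asymptotically_stable : asymptotically_stable S F (fun=> v).
Proof.
have near (y : state R n l.+1) d i : 0 < d -> d <= 1 -> S y ->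
    state_dist y (fun=> v) < d -> 2^-1 <= dotv v (y i).
  move=> d0 d1 Sy yd; apply: le_trans (state_dist_ge i d0 Sy yd); nra.
split.
  move=> e e0.
  have [|del del0 Hdel] := @solution_stable l.+1 (e ^+ 2 / (4 * l.+1%:R)).
    by rewrite divr_gt0// exprn_gt0.
  (* The cap 1 keeps all initial cosines at least 1/2; it also gives d^2 / 2 <= d <= [del]. *)
  exists (Num.min 1 del); first by rewrite lt_min del0 ltr01.
  set d := Num.min 1 del.
  have d0 : 0 < d by rewrite lt_min del0 ltr01.
  have d1 : d <= 1 by rewrite ge_min lexx.
  have dd : d <= del by rewrite ge_min lexx orbT.
  move=> y sy yd t t0; have [Sy _ _] := sy.
  have h i : 2^-1 <= dotv v (y 0 i) by exact: (near _ _ i d0 d1 (Sy 0 (lexx _)) yd).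
  apply: state_dist_lt => //; first exact: Sy.
  move=> i; apply: Hdel => // [j|j].
    by apply: lt_le_trans (h j); rewrite invr_gt0.
  by apply: le_trans (state_dist_ge j d0 (Sy 0 (lexx _)) yd); nra.
exists 1 => // y0 [Sy0 yd]; apply: hemisphere_attracted; split => // i.
by apply: lt_le_trans (near _ _ i ltr01 (lexx _) Sy0 yd) => //; rewrite invr_gt0.
Qed.

End AutoRegressiveAttention.

Unset Implicit Arguments.

(* The library's eigenspace is the row space of row eigenvectors, u *m U =
   lambda *: u; as U is symmetric these are the transposes of the column
   eigenvectors. *)
Theorem theorem5p2 (R : realType) (n l : nat) (hn : (0 < n)%N) (hl : (0 < l)%N)
    (U : 'M[R]_n.+1) (hU : U^T = U)
    (P : R -> 'M[R]_n.+1)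
    (hP : has_ubound [set fnorm (P t) | t in [set t : R | 0 <= t]])
    (lambda : R) (hlambda : largest_eigenvalue U lambda)
    (hdim : \rank (eigenspace U lambda) = 1%N)
    (v : 'cV[R]_n.+1) (hv : (v^T <= eigenspace U lambda)%MS)
    (hvS : unit_sphere R n v)
    (hpos : 0 < lambda) :
  let ystar : state R n l := fun=> v in
  [/\ is_equilibrium (sphere_prod R n l) (attn_field U P) ystar,
      asymptotically_stable (sphere_prod R n l) (attn_field U P) ystar
    & open_hemisphere_prod v
        `<=` domain_of_attraction (sphere_prod R n l) (attn_field U P) ystar].
Proof.
(* The estimates are stated for [l.+1] tokens, so that the first token [ord0] exists. *)
case: l hl => // l' _ ystar.
have Uv : U *m v = lambda *: v.
  by move/eigenspaceP : hv => H; apply: trmx_inj; rewrite trmx_mul hU H linearZ.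
have [mu mulambda gap] := spectral_gap hU hlambda hdim hv hvS.
have [B HB] := hP.
have PB t : 0 <= t -> fnorm (P t) <= B by move=> t0; apply: HB; exists t.
split.
- exact: (equilibrium_diag _ _ Uv hvS).
- exact: (diag_asymptotically_stable _ hU Uv hvS hpos mulambda gap PB).
- exact: (hemisphere_attracted hU Uv hvS hpos mulambda gap PB).
Qed.
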